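(* Let the gPC basis $\phi_0,\dots,\phi_K$ satisfy properties (A1)--(A3), let $\hat h:\mathbb{H}^+\to\mathbb{R}^{K+1}$ be a (smooth) stochastic Galerkin formulation of a hesitation function and $\widehat{V_{\mathrm{eq}}}:\mathbb{H}^+\to\mathbb{R}^{K+1}$ a (smooth) Galerkin formulation of an equilibrium velocity. Assume that for all $\hat\rho\in\mathbb{H}^+$ the Jacobians can be written as $$\widehat{V_{\mathrm{eq}}'}(\hat\rho):=\mathrm{D}_{\hat\rho}\widehat{V_{\mathrm{eq}}}(\hat\rho)=V\,\mathcal{D}_{V_{\mathrm{eq}}'}(\hat\rho)\,V^{T},\qquad \widehat{h'}(\hat\rho):=\mathrm{D}_{\hat\rho}\hat h(\hat\rho)=V\,\mathcal{D}_{h'}(\hat\rho)\,V^{T},$$ with the constant matrix $V$ of eigenvectors from (A2), and with $\mathcal{D}_{V_{\mathrm{eq}}'}(\hat\rho)$, $\mathcal{D}_{h'}(\hat\rho)$ diagonal. Then: (i) The first-order (Chapman--Enskog) correction to the local equilibrium approximation of the system $$(\mathcal{N})\quad\begin{cases}\partial_t\hat\rho+\partial_x\big(\mathcal{P}(\hat\rho)\hat v\big)=\vec 0,\\ \partial_t\big(\hat v+\hat h(\hat\rho)\big)+\mathcal{P}(\hat v)\,\partial_x\big(\hat v+\hat h(\hat\rho)\big)=\frac1\tau\big(\widehat{V_{\mathrm{eq}}}(\hat\rho)-\hat v\big)\end{cases}$$ reads $$\partial_t\hat\rho+\partial_x\widehat{\mathbf f_{\mathrm{eq}}}(\hat\rho)=\tau\,\partial_x\big(\hat\mu(\hat\rho)\,\partial_x\hat\rho\big),\qquad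 \widehat{\mathbf f_{\mathrm{eq}}}(\hat\rho)=\mathcal{P}(\hat\rho)\widehat{V_{\mathrm{eq}}}(\hat\rho),$$ $$\hat\mu(\hat\rho):=-\,V\Big[\mathcal{D}(\hat\rho)^2\,\mathcal{D}_{V_{\mathrm{eq}}'}(\hat\rho)\big(\mathcal{D}_{V_{\mathrm{eq}}'}(\hat\rho)+\mathcal{D}_{h'}(\hat\rho)\big)\Big]V^{T};$$ that is, every family of smooth solutions of $(\mathcal{N})$ admitting a Chapman--Enskog expansion $\hat v=\widehat{V_{\mathrm{eq}}}(\hat\rho)+\tau\,\widehat{v^{(1)}}+\mathcal{O}(\tau^2)$ satisfies $$\partial_t\hat\rho+\partial_x\widehat{\mathbf f_{\mathrm{eq}}}(\hat\rho)=\tau\,\partial_x\big(\hat\mu(\hat\rho)\,\partial_x\hat\rho\big)+\mathcal{O}(\tau^2).$$ (ii) Suppose moreover that all diagonal entries of $\mathcal{D}_{V_{\mathrm{eq}}'}(\hat\rho)$ are strictly negative. Then this first-order correction is dissipative (i.e. $\hat\mu(\hat\rho)$ is positive semidefinite) if and only if the sub-characteristic condition $$\widehat{\lambda_1}(\hat\rho,\hat z)\le\widehat{\lambda_{\mathrm{eq}}}(\hat\rho)\le\widehat{\lambda_2}(\hat\rho,\hat z)\qquad\text{holds on}\qquad\hat z=\mathcal{P}(\hat\rho)\big(\widehat{V_{\mathrm{eq}}}(\hat\rho)+\hat h(\hat\rho)\big),$$ where the inequalities between diagonal matrices are understood entrywise on the diagonal.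
   Context: Let $\xi$ be a random variable on a probability space with law $\mathbb{P}$, and let $\phi_0,\dots,\phi_K$ be real (piecewise polynomial) functions, orthonormal for $\langle f,g\rangle=\int f(\xi)g(\xi)\,d\mathbb{P}$, with all triple products integrable (a gPC basis). Define the symmetric matrices $\mathcal{M}_k=\big(\langle\phi_k,\phi_i\phi_j\rangle\big)_{i,j=0,\dots,K}$ and, for $\hat\alpha\in\mathbb{R}^{K+1}$, the linear operator $\mathcal{P}(\hat\alpha)=\sum_{k=0}^K\hat\alpha_k\mathcal{M}_k\in\mathbb{R}^{(K+1)\times(K+1)}$. The Galerkin product is $\hat\alpha\ast\hat\beta:=\mathcal{P}(\hat\alpha)\hat\beta$; it is symmetric. The following equivalent properties are assumed of the basis: (A1) the matrices $\mathcal{M}_\ell$ and $\mathcal{M}_k$ commute for all $\ell,k=0,\dots,K$; (A2) there is an eigenvalue decomposition $\mathcal{P}(\hat\alpha)=V\mathcal{D}(\hat\alpha)V^{T}$ for all $\hat\alpha\in\mathbb{R}^{K+1}$, with a constant orthogonal matrix $V$ (independent of $\hat\alpha$) and $\mathcal{D}(\hat\alpha)$ diagonal; (A3) $\mathcal{P}(\hat\alpha)$ and $\mathcal{P}(\hat\beta)$ commute for all $\hat\alpha,\hat\beta\in\mathbb{R}^{K+1}$. Throughout, $V$ and $\mathcal{D}(\cdot)$ are those of (A2). Standing assumption (no vacuum): $\mathcal{P}(\hat\rho)$ is strictly positive definite, i.e. $\hat\rho\in\mathbb{H}^+:=\{\hat\alpha\in\mathbb{R}^{K+1}:\mathcal{P}(\hat\alpha)\text{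 is strictly positive definite}\}$. For fixed $K$, a ''stochastic Galerkin formulation'' $\hat h$ of a hesitation function $h$ (resp. $\widehat{V_{\mathrm{eq}}}$ of an equilibrium velocity $V_{\mathrm{eq}}$) is a given map $\mathbb{H}^+\to\mathbb{R}^{K+1}$ returning gPC modes approximating $h(\rho(\xi))$ (resp. $V_{\mathrm{eq}}(\rho(\xi))$); its consistency concerns only the limit $K\to\infty$. $\mathrm{D}$ denotes the Jacobian matrix. Speeds (diagonal matrices): with $\hat v(\hat\rho,\hat z)=\mathcal{P}^{-1}(\hat\rho)\hat z-\hat h(\hat\rho)$, $$\widehat{\lambda_1}(\hat\rho,\hat z)=\mathcal{D}\big(\hat v(\hat\rho,\hat z)\big)-\mathcal{D}_{h'}(\hat\rho)\mathcal{D}(\hat\rho),\quad \widehat{\lambda_2}(\hat\rho,\hat z)=\mathcal{D}\big(\hat v(\hat\rho,\hat z)\big),\quad \widehat{\lambda_{\mathrm{eq}}}(\hat\rho)=\mathcal{D}\big(\widehat{V_{\mathrm{eq}}}(\hat\rho)\big)+\mathcal{D}(\hat\rho)\mathcal{D}_{V_{\mathrm{eq}}'}(\hat\rho).$$ The last are the characteristic speeds of the equilibrium model $\partial_t\hat\rho+\partial_x\widehat{\mathbf f_{\mathrm{eq}}}(\hat\rho)=\vec 0$. Meaning of the Chapman--Enskog expansion: for $\tau\in(0,\tau_0]$ let $(\hat\rho,\hat v)=(\hat\rho^\tau,\hat v^\tau)$ be smooth solutions of $(\mathcal{N})$ on a common open set of $(t,x)$, with $\hat\rho^\tau$ taking values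 (locally uniformly in $\tau$) in compact subsets of $\mathbb{H}^+$. The expansion means $\hat v^\tau=\widehat{V_{\mathrm{eq}}}(\hat\rho^\tau)+\tau\,\widehat{v^{(1)}}+r^\tau$, where $\hat\rho^\tau$ and $\widehat{v^{(1)}}$ (which may depend on $\tau$) and all their $(t,x)$-derivatives are bounded uniformly in $\tau$ on compact sets, and $r^\tau=\mathcal{O}(\tau^2)$ together with all its derivatives, uniformly on compact sets. The first-order correction is the closed equation for $\hat\rho$ obtained from the first equation of $(\mathcal{N})$ after inserting this expansion, with $\widehat{v^{(1)}}$ expressed through $\hat\rho$ and $\partial_x\hat\rho$, and discarding $\mathcal{O}(\tau^2)$ terms. *)

(* Defs.v *)
From HB Require Import structures.
From mathcomp Require Import all_boot all_order all_algebra.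
From mathcomp Require Import all_classical all_reals all_analysis.

Set Implicit Arguments.
Unset Strict Implicit.
Unset Printing Implicit Defensive.

Import Order.TTheory GRing.Theory Num.Theory.
Import numFieldNormedType.Exports.

Local Open Scope classical_set_scope.
Local Open Scope ring_scope.

Section matrices.
Context {R : realType} {n : nat}.

Definition positive_definite (A : 'M[R]_n) : Prop :=
  A^T = A /\ forall x : 'cV[R]_n, x != 0 -> 0 < (x^T *m A *m x) 0 0.

Definition positive_semidefinite (A : 'M[R]_n) : Prop :=
  A^T = A /\ forall x : 'cV[R]_n, 0 <= (x^T *m A *m x) 0 0.

Definition orthogonal_mx (A : 'M[R]_n) : Prop := A *m A^T = 1%:M.

Definition diag_le (A B : 'M[R]_n) : Prop := forall i, A i i <= B i i.

End matrices.

Section calculus.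
Context {R : realType}.

(* For column vectors: the (i, j) entry is the j-th partial derivative of f_i.
   (The library's ['J f x] is for row vectors and is the transpose of this.) *)
Definition Jacobian {m n : nat} (f : 'cV[R]_n -> 'cV[R]_m) (x : 'cV[R]_n) :
    'M[R]_(m, n) :=
  \matrix_(i, j) 'D_(delta_mx j 0) f x i 0.

Definition iter_derive {U W : normedModType R} (vs : seq U) (f : U -> W) :
    U -> W :=
  foldr (fun v g => 'D_v g) f vs.

(* C^oo on an open set of a finite-dimensional space: differentiability of all
   the iterated derivatives entails their continuity. *)
Definition smooth_on {U W : normedModType R} (A : set U) (f : U -> W) : Prop :=
  forall (vs : seq U) (x : U), A x -> differentiable (iter_derive vs f) x.

(* Points of the plane are pairs (t, x). *)
Definition dt {W : normedModType R} (u : R * R -> W) : R * R -> W :=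
  'D_(1, 0) u.
Definition dx {W : normedModType R} (u : R * R -> W) : R * R -> W :=
  'D_(0, 1) u.

(* u^tau = O(tau^k) together with all its derivatives, uniformly on the compact
   subsets of Om, for tau in (0, tau0]; k = 0 is uniform boundedness. *)
Definition bigO_tau {W : normedModType R} (tau0 : R) (Om : set (R * R))
    (k : nat) (u : R -> R * R -> W) : Prop :=
  forall (vs : seq (R * R)) (C : set (R * R)), compact C -> C `<=` Om ->
    exists M : R, forall (tau : R) (p : R * R), 0 < tau -> tau <= tau0 -> C p ->
      `|iter_derive vs (u tau) p| <= M * tau ^+ k.

End calculus.

Section gpc_basis.
Context {R : realType} {K : nat}.
Implicit Types (mu : probability R R) (phi : 'I_K.+1 -> R -> R).

Definition piecewise_polynomial (f : R -> R) : Prop :=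
  exists (m : nat) (I : 'I_m -> interval R) (p : 'I_m -> {poly R}),
    (forall x, exists j, x \in I j) /\
    (forall j x, x \in I j -> f x = (p j).[x]).

(* mu is the law of xi. *)
Definition inner mu (f g : R -> R) : R := \int[mu]_x (f x * g x).

(* The case i = j of the orthonormality makes every phi i square integrable,
   as [fine] maps an infinite integral to 0. *)
Definition gpc_basis mu phi : Prop :=
  [/\ forall i, piecewise_polynomial (phi i),
      forall i j, inner mu (phi i) (phi j) = (i == j)%:R &
      forall i j k,
        mu.-integrable setT (fun x => (phi k x * (phi i x * phi j x))%:E)].

Definition Mmx mu phi (k : 'I_K.+1) : 'M[R]_K.+1 :=
  \matrix_(i, j) inner mu (phi k) (fun x => phi i x * phi j x).

Definition Pmx mu phi (alpha : 'cV[R]_K.+1) : 'M[R]_K.+1 :=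
  \sum_(k < K.+1) alpha k 0 *: Mmx mu phi k.

Definition A1 mu phi : Prop :=
  forall l k, comm_mx (Mmx mu phi l) (Mmx mu phi k).

Definition A2 mu phi (V : 'M[R]_K.+1) (D : 'cV[R]_K.+1 -> 'M[R]_K.+1) : Prop :=
  orthogonal_mx V /\
  forall alpha, is_diag_mx (D alpha) /\ Pmx mu phi alpha = V *m D alpha *m V^T.

Definition A3 mu phi : Prop :=
  forall alpha beta, comm_mx (Pmx mu phi alpha) (Pmx mu phi beta).

Definition Hplus mu phi : set 'cV[R]_K.+1 :=
  [set alpha | positive_definite (Pmx mu phi alpha)].

End gpc_basis.

(* Below, P and D stand for the maps alpha |-> P(alpha), D(alpha) of a basis,
   DV and Dh for the diagonal parts of the Jacobians of Veq and h. *)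
Section model.
Context {R : realType} {K : nat}.
Implicit Types (P D DV Dh : 'cV[R]_K.+1 -> 'M[R]_K.+1).
Implicit Types (V : 'M[R]_K.+1) (h Veq : 'cV[R]_K.+1 -> 'cV[R]_K.+1).
Implicit Types (rho z : 'cV[R]_K.+1).

Definition velocity P h rho z : 'cV[R]_K.+1 := invmx (P rho) *m z - h rho.

Definition lambda1 P D h Dh rho z : 'M[R]_K.+1 :=
  D (velocity P h rho z) - Dh rho *m D rho.

Definition lambda2 P D h rho z : 'M[R]_K.+1 := D (velocity P h rho z).

Definition lambda_eq D Veq DV rho : 'M[R]_K.+1 :=
  D (Veq rho) + D rho *m DV rho.

Definition f_eq P Veq rho : 'cV[R]_K.+1 := P rho *m Veq rho.

Definition mu_hat V D DV Dh rho : 'M[R]_K.+1 :=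
  - (V *m (D rho ^+ 2 *m DV rho *m (DV rho + Dh rho)) *m V^T).

(* The relaxation system with parameter tau, at every point of Om. *)
Definition solves_N P h Veq (Om : set (R * R)) (tau : R)
    (rho v : R * R -> 'cV[R]_K.+1) : Prop :=
  forall p, Om p ->
    dt rho p + dx (fun q => P (rho q) *m v q) p = 0 /\
    dt (fun q => v q + h (rho q)) p
      + P (v p) *m dx (fun q => v q + h (rho q)) p
    = tau^-1 *: (Veq (rho p) - v p).

(* A family indexed by tau in (0, tau0] of smooth solutions on Om, whose
   densities stay, on each compact subset of Om, in a compact subset of H
   that does not depend on tau. *)
Definition solution_family (H : set 'cV[R]_K.+1) P h Veq (tau0 : R)
    (Om : set (R * R)) (rho v : R -> R * R -> 'cV[R]_K.+1) : Prop :=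
  (forall tau, 0 < tau -> tau <= tau0 ->
     [/\ smooth_on Om (rho tau), smooth_on Om (v tau) &
         solves_N P h Veq Om tau (rho tau) (v tau)]) /\
  (forall C, compact C -> C `<=` Om ->
     exists Q : set 'cV[R]_K.+1, [/\ compact Q, Q `<=` H &
       forall tau p, 0 < tau -> tau <= tau0 -> C p -> Q (rho tau p)]).

Definition chapman_enskog Veq (tau0 : R) (Om : set (R * R))
    (rho v v1 r : R -> R * R -> 'cV[R]_K.+1) : Prop :=
  [/\ forall tau, 0 < tau -> tau <= tau0 ->
        smooth_on Om (v1 tau) /\ smooth_on Om (r tau),
      forall tau p, 0 < tau -> tau <= tau0 -> Om p ->
        v tau p = Veq (rho tau p) + tau *: v1 tau p + r tau p,
      bigO_tau tau0 Om 0 rho,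
      bigO_tau tau0 Om 0 v1 &
      bigO_tau tau0 Om 2 r].

End model.

(* Main.v *)
(** Write [G = Veq + h] and [e = tau v1 + r = O(tau)], so that
    [v = Veq(rho) + e]. The second equation of (N) expresses [v1] through
    [dt rho], [dx rho], [e] and [r / tau = O(tau)]; the first one eliminates
    [dt rho]. Since all [P(alpha)] and both Jacobians are diagonal in the basis
    [V], they commute, the terms [P(v) G' dx rho] cancel, and
    [v1 = G' P(rho) Veq' dx rho + O(tau)]. Hence [mu dx rho] equals
    [- P(rho) v1] up to O(tau), and the residual is minus the x-derivative of
    [P(rho) (tau E + r)] with [E = O(tau)].
    The bounds are required for all derivatives at once; they follow from the
    stability of such families under sums, products and composition with
    smooth maps.
    For the equivalence, conjugating by [V] reduces both sides to
    [0 <= DV_ii + Dh_ii], because [D(rho)_ii > 0 > DV_ii]. *)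

Require Import Defs.
From HB Require Import structures.
From mathcomp Require Import all_boot all_order all_algebra.
From mathcomp Require Import ring.
From mathcomp Require Import all_classical all_reals all_analysis.

Import Order.TTheory GRing.Theory Num.Theory.
Import numFieldNormedType.Exports.

Local Open Scope classical_set_scope.
Local Open Scope ring_scope.

(** * Differential calculus for matrix-valued functions *)

Section matrix_calculus.
Context {R : realType} {U : normedModType R}.

(** The difference [g - f] vanishes near [x], so it has differential 0 there, and [g] is [f] plus
    this difference. *)
Lemma near_eq_differentiable {W : normedModType R} (f g : U -> W) (x : U) :
  (\near x, f x = g x) -> differentiable f x -> differentiable g x.
Proof.
move=> fg df.
pose z : U -> W := g - f.
have z0 : \near x, z x = 0.
  by apply: filterS fg => y fgy; rewrite /z !fctE fgy subrr.
(* First-order expansion with zero linear part; the remainder is equal to 0 near the origin, hence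
   negligible. *)
have zo : z \o shift x = cst (z x) + cst 0 +o_ 0 id.
  apply/eqaddoP => _/posnumP[eps].
  rewrite (nbhs_singleton z0).
  have : \forall y \near 0, z (y + x) = 0.
    move: z0; rewrite (near_shift 0 x)/=; apply: filterS => y /=.
    by rewrite subr0.
  apply: filterS => y /= zy.
  by rewrite !fctE /= zy /cst addr0 subr0 normr0 mulr_ge0.
have dz0 : 'd z x = cst 0 :> (U -> W).
  exact: (@diff_unique _ _ _ _ (GRing.null_fun _) _ (dcst 0 x).1 zo).
have dz : differentiable z x.
  by apply/diff_locallyP; rewrite dz0; split => //; exact: cst_continuous.
have -> : g = f + z by rewrite /z addrC subrK.
exact: differentiableD.
Qed.

(** A linear map on matrices is a finite sum of coordinate functions times fixed vectors. *)
Lemma differentiable_linear_mx {m n : nat} {W : normedModType R}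
    (f : {linear 'M[R]_(m, n) -> W}) x : differentiable f x.
Proof.
have -> : f = (\sum_i \sum_j
    ((fun A : 'M[R]_(m, n) => A i j *: f (delta_mx i j)))) :> (_ -> _).
  apply/funext => A; rewrite [in LHS](matrix_sum_delta A) linear_sum fct_sumE.
  apply: eq_bigr => i _; rewrite linear_sum fct_sumE.
  by apply: eq_bigr => j _; rewrite linearZ.
apply: differentiable_sum => i; apply: differentiable_sum => j.
exact/differentiableZl/differentiable_coord.
Qed.

Lemma continuous_linear_mx {m n : nat} {W : normedModType R}
  (f : {linear 'M[R]_(m, n) -> W}) : continuous f.
Proof.
by move=> x; exact/differentiable_continuous/differentiable_linear_mx.
Qed.

Lemma derive_linear_mx {m n : nat} {W : normedModType R}
    (f : {linear 'M[R]_(m, n) -> W}) (u : U -> 'M[R]_(m, n)) x v :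
  differentiable u x -> 'D_v (fun y => f (u y)) x = f ('D_v u x).
Proof.
move=> du; have df := differentiable_linear_mx f (u x).
rewrite [LHS]deriveE ?(diff_comp du)//=; last exact: differentiable_comp.
rewrite diff_lin; last exact: continuous_linear_mx.
by rewrite deriveE.
Qed.

Lemma differentiable_mx {m n : nat} (u : U -> 'M[R]_(m, n)) x :
  (forall i j, differentiable (fun y => u y i j) x) -> differentiable u x.
Proof.
move=> du.
have -> : u = \sum_i \sum_j (fun y => u y i j *: delta_mx i j).
  apply/funext => y; rewrite [in LHS](matrix_sum_delta (u y)) fct_sumE.
  by apply: eq_bigr => i _; rewrite fct_sumE.
apply: differentiable_sum => i; apply: differentiable_sum => j.
exact: differentiableZl.
Qed.

Lemma differentiable_entry {m n : nat} (u : U -> 'M[R]_(m, n)) x i j :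
  differentiable u x -> differentiable (fun y => u y i j) x.
Proof.
move=> du; apply: (@differentiable_comp _ _ _ _ u (fun M => M i j)) => //.
exact: differentiable_coord.
Qed.

Lemma mulmx_entryE {m n p : nat} (A : U -> 'M[R]_(m, n))
    (B : U -> 'M[R]_(n, p)) i k :
  (fun y => (A y *m B y) i k) =
  \sum_j ((fun y => A y i j) * (fun y => B y j k)).
Proof. by apply/funext => y; rewrite mxE fct_sumE. Qed.

Lemma differentiable_mulmx {m n p : nat} (A : U -> 'M[R]_(m, n))
    (B : U -> 'M[R]_(n, p)) x :
  differentiable A x -> differentiable B x ->
  differentiable (fun y => A y *m B y) x.
Proof.
move=> dA dB; apply: differentiable_mx => i k; rewrite mulmx_entryE.
apply: differentiable_sum => j.
by apply: differentiableM; exact: differentiable_entry.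
Qed.

Lemma derive_mulmx {m n p : nat} (A : U -> 'M[R]_(m, n))
    (B : U -> 'M[R]_(n, p)) x v :
  differentiable A x -> differentiable B x ->
  'D_v (fun y => A y *m B y) x = 'D_v A x *m B x + A x *m 'D_v B x.
Proof.
move=> dA dB; rewrite derive_mx; last first.
  exact/diff_derivable/differentiable_mulmx.
apply/matrixP => i k; rewrite !mxE mulmx_entryE derive_sum; last first.
  move=> j; apply/diff_derivable/differentiableM; exact: differentiable_entry.
rewrite -big_split; apply: eq_bigr => j _ /=.
rewrite deriveM; [|exact/diff_derivable/differentiable_entry..].
rewrite (derive_mx (diff_derivable dA)) (derive_mx (diff_derivable dB)).
by rewrite !mxE addrC /GRing.scale/= [_ * B x j k]mulrC.
Qed.

(** The norm is the largest absolute entry, and an entry of the product is a sum of [n] terms; hence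
    the factor [n]. *)
Lemma ler_norm_mulmx {m n p : nat} (A : 'M[R]_(m, n)) (B : 'M[R]_(n, p)) :
  `|A *m B| <= n%:R * (`|A| * `|B|).
Proof.
have entry a b (C : 'M[R]_(a, b)) i j : `|C i j| <= `|C|.
  by rewrite [leRHS]/Num.Def.normr/= mx_normrE; exact: (le_bigmax _ _ (i, j)).
rewrite [leLHS]/Num.Def.normr/= mx_normrE bigmax_le ?mulr_ge0// => -[i k] _ /=.
rewrite mxE (le_trans (ler_norm_sum _ _ _))//.
rewrite (le_trans (ler_sum _ (fun j _ => _ : _ <= `|A| * `|B|)))//.
  by move=> j _; rewrite normrM ler_pM.
by rewrite sumr_const card_ord mulr_natl.
Qed.

End matrix_calculus.
Lemma derive_comp_jacobian {R : realType} {U : normedModType R} {m n : nat}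
    (f : 'cV[R]_n -> 'cV[R]_m) (u : U -> 'cV[R]_n) x v :
  differentiable u x -> differentiable f (u x) ->
  'D_v (fun y => f (u y)) x = Jacobian f (u x) *m 'D_v u x.
Proof.
move=> du df.
rewrite [LHS]deriveE ?(diff_comp du)//=; last exact: differentiable_comp.
rewrite -(deriveE v du); move: ('D_v u x) => w.
rewrite [in LHS](matrix_sum_delta w) linear_sum/=.
apply/matrixP => i j; rewrite !ord1 mxE summxE.
apply: eq_bigr => k _; rewrite big_ord1 linearZ !mxE/= mulrC.
by rewrite deriveE.
Qed.

(** [iter_derive] applies the last direction of the list first, so inductions over lists of
    directions peel them from the right. *)
Lemma iter_derive_rcons {R : realType} {U W : normedModType R} (vs : seq U) v
    (f : U -> W) :
  iter_derive (rcons vs v) f = iter_derive vs ('D_v f).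
Proof. exact: foldr_rcons. Qed.

Lemma smooth_on_derive {R : realType} {U W : normedModType R} (A : set U)
    (f : U -> W) v :
  smooth_on A f -> smooth_on A ('D_v f).
Proof. by move=> sf vs x Ax; rewrite -iter_derive_rcons; exact: sf. Qed.

(** * Families of order [tau ^ k] together with their derivatives *)

Section regular_families.
Context {R : realType} (tau0 : R) (Om : set (R * R)).

(** Base layer of [regular_O], the inductive substitute for [bigO_tau]. Differentiability
    accompanies the bound for the sake of the sum, product and chain rules; [0 <= M] lets bounds be
    multiplied. *)
Definition differentiable_O {W : normedModType R} (k : nat)
    (u : R -> R * R -> W) :=
  (forall tau p, 0 < tau -> tau <= tau0 -> Om p -> differentiable (u tau) p) /\
  forall C : set (R * R), compact C -> C `<=` Om -> exists2 M : R, 0 <= M &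
    forall tau p, 0 < tau -> tau <= tau0 -> C p -> `|u tau p| <= M * tau ^+ k.

(* [n] counts the derivatives that are controlled. *)
Fixpoint regular_O {W : normedModType R} (n k : nat) (u : R -> R * R -> W) :
    Prop :=
  differentiable_O k u /\
  if n is n'.+1 then forall v, regular_O n' k (fun tau => 'D_v (u tau))
  else True.

Lemma regular_O_differentiable {W : normedModType R} n k (u : R -> R * R -> W)
    tau p :
  regular_O n k u -> 0 < tau -> tau <= tau0 -> Om p ->
  differentiable (u tau) p.
Proof. by case: n => [|n] [[du _] _]; exact: du. Qed.

Lemma bigO_tau_regular {W : normedModType R} n k (u : R -> R * R -> W) :
  (forall tau, 0 < tau -> tau <= tau0 -> smooth_on Om (u tau)) ->
  bigO_tau tau0 Om k u -> regular_O n k u.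
Proof.
elim: n u => [|n IHn] u su bu.
all: split=> //.
1,2: split=> [tau p t0 t1 Op|C cC CO]; first exact: (su tau t0 t1 [::]).
1,2: have [M uM] := bu [::] C cC CO; exists `|M| => // tau p t0 t1 Cp.
1,2: rewrite (le_trans (uM _ _ t0 t1 Cp))//.
1,2: by rewrite ler_wpM2r ?exprn_ge0 ?(ltW t0)// ler_norm.
move=> v; apply: IHn => [tau t0 t1|vs C cC CO].
  exact/smooth_on_derive/su.
have [M uM] := bu (rcons vs v) C cC CO; exists M => tau p t0 t1 Cp.
by rewrite -iter_derive_rcons; exact: uM.
Qed.

(** A list of directions uses up as many controlled derivatives as its length, so control for every
    [n] covers all lists. *)
Lemma regular_bigO_tau {W : normedModType R} k (u : R -> R * R -> W) :
  (forall n, regular_O n k u) -> bigO_tau tau0 Om k u.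
Proof.
move=> ru vs; move: (ru (size vs)) => {ru}.
elim/last_ind: vs u => [|vs v IHvs] u.
  by move=> [[_ bu] _] C cC CO; have [M _ uM] := bu C cC CO; exists M.
rewrite size_rcons => -[_ /(_ v) ru] C cC CO.
have [M uM] := IHvs _ ru C cC CO; exists M => tau p t0 t1 Cp.
by rewrite iter_derive_rcons; exact: uM.
Qed.

Lemma regular_O_pred {W : normedModType R} n k (u : R -> R * R -> W) :
  regular_O n.+1 k u -> regular_O n k u.
Proof.
elim: n u => [|n IHn] u [du ru]; first by split.
by split=> // v; apply: IHn; exact: ru.
Qed.

Lemma regular_O_cst {W : normedModType R} n (a : W) :
  regular_O n 0 (fun _ _ => a).
Proof.
elim: n a => [|n IHn] a.
all: split=> //.
1,2: split=> [*|C cC CO]; first exact: differentiable_cst.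
1,2: by exists `|a| => // *; rewrite expr0 mulr1.
move=> v; rewrite (_ : (fun _ => _) = (fun _ _ => 0)); first exact: IHn.
by apply/funext => tau; apply/funext => p; exact: derive_cst.
Qed.

Hypothesis Om_open : open Om.

Lemma near_open p (Q : R * R -> Prop) :
  Om p -> (forall q, Om q -> Q q) -> \near p, Q p.
Proof. by move=> Op OQ; apply: filterS OQ _; exact: open_nbhs_nbhs. Qed.

(** [Om] is open, so agreement on [Om] is agreement near each of its points and passes to all
    derivatives. *)
Lemma eq_regular_O {W : normedModType R} n k (u w : R -> R * R -> W) :
  (forall tau p, 0 < tau -> tau <= tau0 -> Om p -> u tau p = w tau p) ->
  regular_O n k u -> regular_O n k w.
Proof.
elim: n u w => [|n IHn] u w uw [[du bu] ru].
all: split=> //.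
1,2: split=> [tau p t0 t1 Op|C cC CO].
1,3: apply: near_eq_differentiable (du _ _ t0 t1 Op).
1,2: by apply: near_open => // q Oq; exact: uw.
1,2: have [M M0 uM] := bu C cC CO; exists M => // tau p t0 t1 Cp.
1,2: by rewrite -uw; [exact: uM|..|exact: CO].
move=> v; apply: IHn (ru v) => tau p t0 t1 Op.
by apply: near_eq_derive; apply: near_open => // q Oq; exact: uw.
Qed.

Lemma regular_OD {W : normedModType R} n k (u w : R -> R * R -> W) :
  regular_O n k u -> regular_O n k w ->
  regular_O n k (fun tau p => u tau p + w tau p).
Proof.
elim: n u w => [|n IHn] u w [[du bu] ru] [[dw bw] rw].
all: split=> //.
1,2: split=> [tau p t0 t1 Op|C cC CO].
1,3: by apply: differentiableD; [exact: du|exact: dw].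
1,2: have [M M0 uM] := bu C cC CO; have [N N0 wN] := bw C cC CO.
1,2: exists (M + N) => [|tau p t0 t1 Cp]; first exact: addr_ge0.
1,2: rewrite mulrDl (le_trans (ler_normD _ _))// lerD//.
1,3: exact: uM.
1,2: exact: wN.
move=> v; apply: eq_regular_O (IHn _ _ (ru v) (rw v)) => tau p t0 t1 Op.
by rewrite deriveD//; apply: diff_derivable; [exact: du|exact: dw].
Qed.

(** [c tau] is constant in [(t, x)] and commutes with every derivative, so one scalar inequality
    settles the change of order from [k] to [l]. *)
Lemma regular_OZ {W : normedModType R} n k l (c : R -> R)
    (u : R -> R * R -> W) :
  (exists2 M, 0 <= M &
    forall tau, 0 < tau -> tau <= tau0 ->
      `|c tau| * tau ^+ k <= M * tau ^+ l) ->
  regular_O n k u -> regular_O n l (fun tau p => c tau *: u tau p).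
Proof.
move=> [N N0 cN].
elim: n u => [|n IHn] u [[du bu] ru].
all: split=> //.
1,2: split=> [tau p t0 t1 Op|C cC CO].
1,3: by apply: differentiableZ; exact: du.
1,2: have [M M0 uM] := bu C cC CO.
1,2: exists (M * N) => [|tau p t0 t1 Cp]; first exact: mulr_ge0.
1,2: rewrite normrZ (le_trans (ler_wpM2l (normr_ge0 _) (uM _ _ t0 t1 Cp)))//.
1,2: by rewrite mulrCA -mulrA ler_wpM2l// cN.
move=> v; apply: eq_regular_O (IHn _ (ru v)) => tau p t0 t1 Op.
by rewrite deriveZ//; apply: diff_derivable; exact: du.
Qed.

(** Since [tau <= tau0], one power of [tau] can be traded for the constant [|tau0|]. *)
Lemma regular_OS {W : normedModType R} n k (u : R -> R * R -> W) :
  regular_O n k.+1 u -> regular_O n k u.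
Proof.
move=> ru; apply: (@eq_regular_O _ _ _ (fun tau p => 1 *: u tau p)).
  by move=> *; rewrite scale1r.
apply: regular_OZ ru; exists `|tau0| => // tau t0 t1.
rewrite normr1 mul1r exprS ler_wpM2r ?exprn_ge0 ?(ltW t0)//.
by rewrite (le_trans t1)// ler_norm.
Qed.

Lemma regular_OZtau {W : normedModType R} n k (u : R -> R * R -> W) :
  regular_O n k u -> regular_O n k.+1 (fun tau p => tau *: u tau p).
Proof.
apply: (regular_OZ _ _ _ id); exists 1 => // tau t0 t1.
by rewrite mul1r exprS ger0_norm ?(ltW t0).
Qed.

Lemma regular_OZtauV {W : normedModType R} n k (u : R -> R * R -> W) :
  regular_O n k.+1 u -> regular_O n k (fun tau p => tau^-1 *: u tau p).
Proof.
apply: (regular_OZ _ _ _ (fun tau => tau^-1)); exists 1 => // tau t0 t1.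
by rewrite mul1r exprS ger0_norm ?invr_ge0 ?(ltW t0)// mulKf ?gt_eqF.
Qed.

Lemma regular_ON {W : normedModType R} n k (u : R -> R * R -> W) :
  regular_O n k u -> regular_O n k (fun tau p => - u tau p).
Proof.
move=> ru; apply: (@eq_regular_O _ _ _ (fun tau p => (-1) *: u tau p)).
  by move=> *; rewrite scaleN1r.
apply: (regular_OZ _ _ _ (fun=> -1)) ru.
by exists 1 => // *; rewrite normrN1.
Qed.

Lemma regular_O_linear {m n : nat} {W : normedModType R}
    (f : {linear 'M[R]_(m, n) -> W}) N k (u : R -> R * R -> 'M[R]_(m, n)) :
  regular_O N k u -> regular_O N k (fun tau p => f (u tau p)).
Proof.
have [c c0 fc] := linear_lipschitz (continuous_linear_mx f).
elim: N u => [|N IHN] u [[du bu] ru].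
all: split=> //.
1,2: split=> [tau p t0 t1 Op|C cC CO].
1,3: apply: (@differentiable_comp _ _ _ _ (u tau) f); first exact: du.
1,2: exact: differentiable_linear_mx.
1,2: have [M M0 uM] := bu C cC CO.
1,2: exists (c * M) => [|tau p t0 t1 Cp]; first exact: mulr_ge0 (ltW c0) _.
1,2: by rewrite (le_trans (fc _))// -mulrA ler_wpM2l ?(ltW c0)// uM.
move=> v; apply: eq_regular_O (IHN _ (ru v)) => tau p t0 t1 Op.
by rewrite derive_linear_mx//; exact: du.
Qed.

(** Leibniz rule and induction on [n]. In each term one factor stays undifferentiated;
    [regular_O_pred] brings it down to the level of the other. *)
Lemma regular_O_mulmx {a b c : nat} n k l (u : R -> R * R -> 'M[R]_(a, b))
    (w : R -> R * R -> 'M[R]_(b, c)) :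
  regular_O n k u -> regular_O n l w ->
  regular_O n (k + l) (fun tau p => u tau p *m w tau p).
Proof.
elim: n u w => [|n IHn] u w.
all: move=> /[dup] reg_u [[du bu] ru] /[dup] reg_w [[dw bw] rw]; split=> //.
1,2: split=> [tau p t0 t1 Op|C cC CO].
1,3: by apply: differentiable_mulmx; [exact: du|exact: dw].
1,2: have [M M0 uM] := bu C cC CO; have [N N0 wN] := bw C cC CO.
1,2: exists (b%:R * (M * N)) => [|tau p t0 t1 Cp]; first by rewrite !mulr_ge0.
1,2: rewrite (le_trans (ler_norm_mulmx _ _))// exprD -mulrA ler_wpM2l//.
1,2: by rewrite mulrACA ler_pM// ?uM ?wN.
move=> v; have := regular_OD _ _ _ _
  (IHn _ _ (ru v) (regular_O_pred _ _ _ reg_w))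
  (IHn _ _ (regular_O_pred _ _ _ reg_u) (rw v)).
apply: eq_regular_O => tau p t0 t1 Op.
by rewrite derive_mulmx//; [exact: du|exact: dw].
Qed.

Section composition.
Context {n : nat} (H : set 'cV[R]_n) (rho : R -> R * R -> 'cV[R]_n).
Hypothesis rho_regular : forall N, regular_O N 0 rho.
Hypothesis rho_compact : forall C, compact C -> C `<=` Om ->
  exists Q : set 'cV[R]_n, [/\ compact Q, Q `<=` H &
    forall tau p, 0 < tau -> tau <= tau0 -> C p -> Q (rho tau p)].

Lemma family_in_domain tau p :
  0 < tau -> tau <= tau0 -> Om p -> H (rho tau p).
Proof.
move=> t0 t1 Op; have p1 : [set p] `<=` Om by move=> _ ->.
have [Q [_ QH rhoQ]] := rho_compact _ (@compact_set1 _ p) p1.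
exact/QH/rhoQ.
Qed.

(** Chain rule shaped for the induction in [regular_O_comp]: the first factor of each summand is a
    column-valued function of [u], like [f] itself. *)
Lemma derive_compE {m : nat} (f : 'cV[R]_n -> 'cV[R]_m) (u : R * R -> 'cV[R]_n)
    p v : differentiable u p -> differentiable f (u p) ->
  'D_v (fun q => f (u q)) p =
  \sum_j 'D_(delta_mx j 0) f (u p) *m (delta_mx 0 j *m 'D_v u p).
Proof.
move=> du df; rewrite derive_comp_jacobian//.
apply/matrixP => i k; rewrite mxE summxE; apply: eq_bigr => j _.
by rewrite -rowE !mxE big_ord1 !mxE ord1.
Qed.

Lemma regular_O_sum {W : normedModType R} {I : Type} (s : seq I) N k
    (u : I -> R -> R * R -> W) :
  regular_O N k (fun _ _ => 0 : W) ->
  (forall i, regular_O N k (u i)) ->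
  regular_O N k (fun tau p => \sum_(i <- s) u i tau p).
Proof.
move=> r0 ru; elim: s => [|i s IHs].
  by apply: eq_regular_O r0 => *; rewrite big_nil.
by apply: eq_regular_O (regular_OD _ _ _ _ (ru i) IHs) => *; rewrite big_cons.
Qed.

(** On a compact set [rho] stays in a compact [Q] inside [H], where [f] is continuous, hence
    bounded. The chain rule reduces derivatives to ['D_(delta_mx j 0) f] composed with [rho], which
    the induction hypothesis covers because it quantifies over [f]. *)
Lemma regular_O_comp {m : nat} N (f : 'cV[R]_n -> 'cV[R]_m) :
  smooth_on H f -> regular_O N 0 (fun tau p => f (rho tau p)).
Proof.
have drho tau p := regular_O_differentiable 0 _ _ tau p (rho_regular 0).
elim: N f => [|N IHN] f sf.
all: split=> //.
1,2: split=> [tau p t0 t1 Op|C cC CO].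
1,3: apply: (@differentiable_comp _ _ _ _ (rho tau) f); first exact: drho.
1,2: exact/(sf [::])/family_in_domain.
1,2: have [Q [cQ QH rhoQ]] := rho_compact C cC CO.
1,2: have [M [_ fM]] : bounded_set (f @` Q).
1,3: apply/compact_bounded/continuous_compact => //.
1,2: apply/continuous_in_subspaceT => x.
1,2: by rewrite inE => Qx; apply/differentiable_continuous/(sf [::])/QH.
(* [bounded_set] bounds the norm by every constant strictly above [M]; [|M| + 1] is such a constant
   and is nonnegative. *)
1,2: exists (`|M| + 1) => [|tau p t0 t1 Cp]; first by rewrite addr_ge0.
1,2: rewrite expr0 mulr1; apply: (fM (`|M| + 1)).
1,3: by rewrite (le_lt_trans (ler_norm _))// ltrDl.
1,2: by exists (rho tau p) => //; exact: rhoQ.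
move=> v; apply: (@eq_regular_O _ _ _ (fun tau p => \sum_j
  'D_(delta_mx j 0) f (rho tau p) *m (delta_mx 0 j *m 'D_v (rho tau) p))).
  move=> tau p t0 t1 Op; rewrite derive_compE//; first exact: drho.
  exact/(sf [::])/family_in_domain.
apply: regular_O_sum => [|j]; first exact: regular_O_cst.
apply: (regular_O_mulmx _ 0 0).
  by apply: (IHN ('D_(delta_mx j 0) f)); exact: smooth_on_derive.
apply: (regular_O_mulmx _ 0 0); first exact: regular_O_cst.
by case: (rho_regular N.+1) => _; exact.
Qed.

(** The Jacobian is rebuilt from its columns, which are directional derivatives of [f] and hence
    smooth. *)
Lemma regular_O_jacobian {m : nat} N (f : 'cV[R]_n -> 'cV[R]_m) :
  smooth_on H f -> regular_O N 0 (fun tau p => Jacobian f (rho tau p)).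
Proof.
move=> sf; apply: (@eq_regular_O _ _ _ (fun tau p => \sum_j
  'D_(delta_mx j 0) f (rho tau p) *m delta_mx (0 : 'I_1) j)).
  move=> tau p _ _ _; apply/matrixP => i k; rewrite mxE summxE (bigD1 k)//=.
  rewrite big1 ?addr0 => [|j jk]; rewrite mxE big_ord1 !mxE eqxx/=.
    by rewrite mulr1.
  by rewrite eq_sym (negbTE jk) mulr0.
apply: regular_O_sum => [|j]; first exact: regular_O_cst.
apply: (regular_O_mulmx _ 0 0); last exact: regular_O_cst.
by apply: (regular_O_comp _ ('D_(delta_mx j 0) f)); exact: smooth_on_derive.
Qed.

End composition.
End regular_families.

(** * Algebra of matrices diagonal in a common orthogonal basis *)

Section diagonal.
Context {R : realType} {n : nat}.
Implicit Types A B V : 'M[R]_n.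

Lemma mul_diag_mxE {m} A (B : 'M[R]_(n, m)) i j :
  is_diag_mx A -> (A *m B) i j = A i i * B i j.
Proof.
move=> /is_diag_mxP dA; rewrite mxE (bigD1 i)//= big1 ?addr0// => k ki.
by rewrite dA ?mul0r// eq_sym.
Qed.

Lemma is_diag_mx_mul A B : is_diag_mx A -> is_diag_mx B -> is_diag_mx (A *m B).
Proof.
move=> dA /is_diag_mxP dB; apply/is_diag_mxP => i j ij.
by rewrite mul_diag_mxE// dB ?mulr0.
Qed.

Lemma is_diag_mxD A B : is_diag_mx A -> is_diag_mx B -> is_diag_mx (A + B).
Proof.
move=> /is_diag_mxP dA /is_diag_mxP dB; apply/is_diag_mxP => i j ij.
by rewrite mxE dA// dB// addr0.
Qed.

Lemma is_diag_mx_mulC A B : is_diag_mx A -> is_diag_mx B -> A *m B = B *m A.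
Proof.
move=> dA dB; apply/matrixP => i j; rewrite !mul_diag_mxE//.
have [->|ij] := eqVneq i j; first exact: mulrC.
by rewrite (is_diag_mxP dA i j ij) (is_diag_mxP dB i j ij) !mulr0.
Qed.

Lemma conj_orthogonal_mul V A B : orthogonal_mx V ->
  (V *m A *m V^T) *m (V *m B *m V^T) = V *m (A *m B) *m V^T.
Proof.
by move=> /mulmx1C VV; rewrite !mulmxA -(mulmxA (V *m A) V^T V) VV mulmx1.
Qed.

End diagonal.

(** * The residual of the first-order correction *)

Section chapman_enskog_expansion.
Context {R : realType} {K : nat} (P : {linear 'cV[R]_K.+1 -> 'M[R]_K.+1}).
Context (V : 'M[R]_K.+1) (D : 'cV[R]_K.+1 -> 'M[R]_K.+1).
Context (H : set 'cV[R]_K.+1) (h Veq : 'cV[R]_K.+1 -> 'cV[R]_K.+1).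
Context (Dh DV : 'cV[R]_K.+1 -> 'M[R]_K.+1).
Hypothesis P_sym : forall a b, P a *m b = P b *m a.
Hypothesis V_orth : orthogonal_mx V.
Hypothesis P_diag : forall a, is_diag_mx (D a) /\ P a = V *m D a *m V^T.
Hypotheses (h_smooth : smooth_on H h) (Veq_smooth : smooth_on H Veq).
Hypothesis jacobians : forall rho, H rho ->
  [/\ is_diag_mx (DV rho), is_diag_mx (Dh rho),
      Jacobian Veq rho = V *m DV rho *m V^T &
      Jacobian h rho = V *m Dh rho *m V^T].

(** The derivative [G'] of [G = Veq + h]. *)
Let J rho := Jacobian Veq rho + Jacobian h rho.

Lemma jacobian_sumE rho : H rho -> J rho = V *m (DV rho + Dh rho) *m V^T.
Proof.
by move=> /jacobians[_ _ JV Jh]; rewrite /J JV Jh mulmxDr mulmxDl.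
Qed.

(** Both factors are diagonal in the same basis [V]. *)
Lemma galerkin_jacobianC a rho : H rho -> P a *m J rho = J rho *m P a.
Proof.
move=> Hrho; have [dDV dDh _ _] := jacobians _ Hrho.
have [dD ->] := P_diag a; rewrite jacobian_sumE// !conj_orthogonal_mul//.
by rewrite (is_diag_mx_mulC (D a))//; exact: is_diag_mxD.
Qed.

(** The diagonal parts commute, so they can be put in the order in which the elimination of [v1] and
    [dt rho] produces them. *)
Lemma mu_hatE rho : H rho ->
  mu_hat V D DV Dh rho = - (P rho *m J rho *m P rho *m Jacobian Veq rho).
Proof.
move=> Hrho; have [dDV dDh JV _] := jacobians _ Hrho.
have [dD Prho] := P_diag rho.
rewrite /mu_hat jacobian_sumE// JV Prho !conj_orthogonal_mul//.
congr (- (V *m _ *m V^T)); rewrite expr2 -!mulmxA; congr (_ *m _).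
set S := DV rho + Dh rho; have dS : is_diag_mx S by exact: is_diag_mxD.
rewrite (is_diag_mx_mulC (DV rho) S)// mulmxA (is_diag_mx_mulC (D rho) S)//.
by rewrite -mulmxA.
Qed.

Section family.
Context (tau0 : R) (Om : set (R * R)).
Context (rho v v1 r : R -> R * R -> 'cV[R]_K.+1).
Hypothesis Om_open : open Om.
Hypothesis rhoP : solution_family H P h Veq tau0 Om rho v.
Hypothesis vP : chapman_enskog Veq tau0 Om rho v v1 r.

Let reg_rho n : regular_O tau0 Om n 0 rho.
Proof.
case: vP => _ _ brho _ _; apply: bigO_tau_regular brho => tau t0 t1.
by have [] := rhoP.1 tau t0 t1.
Qed.

Let reg_v1 n : regular_O tau0 Om n 0 v1.
Proof.
case: vP => sv _ _ bv _; apply: bigO_tau_regular bv => tau t0 t1.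
by have [] := sv tau t0 t1.
Qed.

Let reg_r n : regular_O tau0 Om n 2 r.
Proof.
case: vP => sv _ _ _ br; apply: bigO_tau_regular br => tau t0 t1.
by have [] := sv tau t0 t1.
Qed.

Let reg_comp n (f : 'cV[R]_K.+1 -> 'cV[R]_K.+1) : smooth_on H f ->
  regular_O tau0 Om n 0 (fun tau p => f (rho tau p)).
Proof. by apply: regular_O_comp => //; exact: rhoP.2. Qed.

Let e tau p := tau *: v1 tau p + r tau p.

Let vE tau p : 0 < tau -> tau <= tau0 -> Om p ->
  v tau p = Veq (rho tau p) + e tau p.
Proof. by case: vP => _ vE _ _ _ t0 t1 Op; rewrite vE// addrA. Qed.

Let reg_e n : regular_O tau0 Om n 1 e.
Proof.
by apply: regular_OD => //; [exact: regular_OZtau|exact: regular_OS].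
Qed.

(** The bounds on [v] are inherited from [Veq(rho) + e]. *)
Let reg_v n : regular_O tau0 Om n 0 v.
Proof.
apply: eq_regular_O (regular_OD _ _ _ _ _ _ _ (reg_comp n Veq Veq_smooth) _).
- by [].
- by move=> tau p t0 t1 Op; rewrite vE.
- by [].
- exact: regular_OS.
Qed.

Let reg_d n k (u : R -> R * R -> 'cV[R]_K.+1) w :
  (forall N, regular_O tau0 Om N k u) ->
  regular_O tau0 Om n k (fun tau => 'D_w (u tau)).
Proof. by move=> ru; case: (ru n.+1) => _; exact. Qed.

(* The O(tau) discrepancy between [v1] and its leading order
   J P(rho) Veq'(rho) dx rho, see [first_correctionE]. *)
Let E tau p : 'cV[R]_K.+1 :=
  J (rho tau p) *m (P (rho tau p) *m dx (e tau) p)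
  - (tau^-1 *: r tau p + (dt (e tau) p + P (v tau p) *m dx (e tau) p)).

Let reg_P n k u : regular_O tau0 Om n k u ->
  regular_O tau0 Om n k (fun tau p => P (u tau p)).
Proof. exact: regular_O_linear. Qed.

(** Each term contains a derivative of [e] or is [r / tau], all of order 1; the coefficients [J],
    [P(rho)] and [P(v)] have order 0. *)
Let reg_E n : regular_O tau0 Om n 1 E.
Proof.
apply: regular_OD => //.
  apply: (regular_O_mulmx _ _ Om_open _ 0 1).
    apply: regular_OD => //; apply: (regular_O_jacobian _ _ _ H) => //.
    1,2: exact: rhoP.2.
  by apply: (regular_O_mulmx _ _ Om_open _ 0 1); [exact: reg_P|exact: reg_d].
apply: regular_ON => //; apply: regular_OD => //; first exact: regular_OZtauV.
apply: regular_OD => //; first exact: reg_d.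
by apply: (regular_O_mulmx _ _ Om_open _ 0 1); [exact: reg_P|exact: reg_d].
Qed.

Let rho_H tau p : 0 < tau -> tau <= tau0 -> Om p -> H (rho tau p).
Proof. exact: (family_in_domain _ _ _ _ rhoP.2). Qed.

(** * Exact identities at a fixed [tau] *)

Section point.
Context (tau : R) (t0 : 0 < tau) (t1 : tau <= tau0).

Let drho p : Om p -> differentiable (rho tau) p.
Proof. exact: regular_O_differentiable (reg_rho 0) t0 t1. Qed.

Let dv p : Om p -> differentiable (v tau) p.
Proof. exact: regular_O_differentiable (reg_v 0) t0 t1. Qed.

Let de p : Om p -> differentiable (e tau) p.
Proof. exact: regular_O_differentiable (reg_e 0) t0 t1. Qed.

Let dh p : Om p -> differentiable h (rho tau p).
Proof. by move=> Op; exact/(h_smooth [::])/rho_H. Qed.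

Let dVeq p : Om p -> differentiable Veq (rho tau p).
Proof. by move=> Op; exact/(Veq_smooth [::])/rho_H. Qed.

Lemma derive_v w p : Om p -> 'D_w (v tau) p =
  Jacobian Veq (rho tau p) *m 'D_w (rho tau) p + 'D_w (e tau) p.
Proof.
move=> Op; rewrite -derive_comp_jacobian; [|exact: drho|exact: dVeq].
rewrite -deriveD.
- by apply: near_eq_derive; apply: near_open Op _ => // q Oq; rewrite vE.
- apply: diff_derivable.
  apply: (@differentiable_comp _ _ _ _ (rho tau) Veq); first exact: drho.
  exact: dVeq.
- exact/diff_derivable/de.
Qed.

Lemma derive_vh w p : Om p -> 'D_w (fun q => v tau q + h (rho tau q)) p =
  J (rho tau p) *m 'D_w (rho tau) p + 'D_w (e tau) p.
Proof.
move=> Op; rewrite deriveD; last 2 first.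
- exact/diff_derivable/dv.
- apply: diff_derivable.
  by apply: (@differentiable_comp _ _ _ _ (rho tau) h); [exact: drho|exact: dh].
rewrite derive_v// derive_comp_jacobian; [|exact: drho|exact: dh].
by rewrite mulmxDl addrAC.
Qed.

Lemma dt_rhoE p : Om p -> dt (rho tau) p =
  - (P (v tau p) *m dx (rho tau) p
     + P (rho tau p) *m (Jacobian Veq (rho tau p) *m dx (rho tau) p
                         + dx (e tau) p)).
Proof.
move=> Op; have [_ _ /(_ p Op)[/eqP + _]] := rhoP.1 tau t0 t1.
rewrite addr_eq0 => /eqP ->; congr (- _).
rewrite /dx derive_mulmx; last 2 first.
- apply: (@differentiable_comp _ _ _ _ (rho tau) P); first exact: drho.
  exact: differentiable_linear_mx.
- exact: dv.
rewrite derive_linear_mx; last exact: drho.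
(* The product rule yields [P(dx rho) v]; symmetry of the Galerkin product turns it into
   [P(v) dx rho]. *)
by rewrite (P_sym _ (v tau p)) derive_v.
Qed.

Lemma first_correctionE p : Om p -> v1 tau p = E tau p +
  J (rho tau p) *m (P (rho tau p) *m
    (Jacobian Veq (rho tau p) *m dx (rho tau) p)).
Proof.
move=> Op; have [_ _ /(_ p Op)[_]] := rhoP.1 tau t0 t1.
(* Only the relaxation term is expanded: [Veq(rho) - v = - e], and division by [tau] isolates [v1]
   up to [r / tau]. *)
rewrite [X in _ = _ *: (_ - X)]vE// opprD addNKr => mom.
have {mom} -> : v1 tau p = - (tau^-1 *: r tau p) -
    (dt (fun q => v tau q + h (rho tau q)) p
     + P (v tau p) *m dx (fun q => v tau q + h (rho tau q)) p).
  rewrite mom scalerN opprK scalerDr scalerA mulVf ?gt_eqF// scale1r.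
  by rewrite addrC addrK.
have dtE : 'D_(1, 0) (rho tau) p = _ := dt_rhoE p Op.
rewrite /dt /dx !derive_vh// dtE.
rewrite !mulmxDr [P (v tau p) *m (J _ *m _)]mulmxA.
(* Once commuted, [P(v) J dx rho] is opposite to a term contributed by [J dt rho]. *)
rewrite (galerkin_jacobianC (v tau p))//; last exact: rho_H.
rewrite /E /dt /dx mulmxN !mulmxDr !mulmxA.
(* The products become opaque; a linear identity between entries remains, in which [c] cancels. *)
move: (tau^-1 *: r tau p) ('D_(1, 0) (e tau) p) => a b.
move: (J (rho tau p) *m P (v tau p) *m 'D_(0, 1) (rho tau) p) => c.
move: (_ *m Jacobian Veq (rho tau p) *m 'D_(0, 1) (rho tau) p) => d.
move: (J (rho tau p) *m P (rho tau p) *m 'D_(0, 1) (e tau) p) => f.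
move: (P (v tau p) *m 'D_(0, 1) (e tau) p) => g.
by apply/matrixP => i j; rewrite !mxE; ring.
Qed.

(** The error is kept explicitly in [E], so this is an exact identity on [Om] and can be used under
    the x-derivative. *)
Lemma diffusion_fluxE p : Om p ->
  mu_hat V D DV Dh (rho tau p) *m dx (rho tau) p =
  P (rho tau p) *m (E tau p - v1 tau p).
Proof.
move=> Op; rewrite mu_hatE; last exact: rho_H.
by rewrite [in RHS]first_correctionE// opprD addNKr mulNmx mulmxN !mulmxA.
Qed.

(** The first equation gives [dt rho = - dx (P(rho) v)], and [P(rho) v] splits into [f_eq] and
    [P(rho) e]. With the diffusive flux included, [e + tau (E - v1) = tau E + r] removes the part of
    order 1. *)
Lemma residualE p : Om p ->
  dt (rho tau) p + dx (fun q => f_eq P Veq (rho tau q)) p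
  - tau *: dx (fun q => mu_hat V D DV Dh (rho tau q) *m dx (rho tau) q) p =
  - dx (fun q => P (rho tau q) *m (tau *: E tau q + r tau q)) p.
Proof.
move=> Op.
have dP : differentiable (fun q => P (rho tau q)) p.
  exact: regular_O_differentiable (reg_P _ _ _ (reg_rho 0)) t0 t1 Op.
have dVrho : differentiable (fun q => Veq (rho tau q)) p.
  exact: regular_O_differentiable (reg_comp 0 Veq Veq_smooth) t0 t1 Op.
have dE := regular_O_differentiable _ _ _ _ _ _ _ (reg_E 0) t0 t1 Op.
have dv1 := regular_O_differentiable _ _ _ _ _ _ _ (reg_v1 0) t0 t1 Op.
have dr := regular_O_differentiable _ _ _ _ _ _ _ (reg_r 0) t0 t1 Op.
have [_ _ /(_ p Op)[/eqP + _]] := rhoP.1 tau t0 t1.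
rewrite addr_eq0 => /eqP ->.
(* The flux identities hold on [Om] only; openness allows them under [dx]. *)
have near_dx (f g : R * R -> 'cV[R]_K.+1) : (forall q, Om q -> f q = g q) ->
    dx f p = dx g p.
  by move=> fg; apply: near_eq_derive; exact: near_open Op fg.
rewrite (near_dx _ (fun q => P (rho tau q) *m Veq (rho tau q) +
  P (rho tau q) *m e tau q)); last by move=> q Oq; rewrite vE// mulmxDr.
rewrite (near_dx (fun q => mu_hat V D DV Dh _ *m _) _ diffusion_fluxE).
have fluxE : (fun q => P (rho tau q) *m (tau *: E tau q + r tau q)) =
    (fun q => P (rho tau q) *m e tau q)
    + tau *: (fun q => P (rho tau q) *m (E tau q - v1 tau q)).
  apply/funext => q; transitivity (P (rho tau q) *m e tau q
    + tau *: (P (rho tau q) *m (E tau q - v1 tau q))); last by [].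
  rewrite scalemxAr -mulmxDr /e.
  by congr (_ *m _); rewrite [RHS]addrC addrA -scalerDr subrK.
have dep := de p Op.
have dflux : differentiable (fun q => P (rho tau q) *m e tau q) p.
  exact: differentiable_mulmx.
have dcorr : differentiable
    (fun q => P (rho tau q) *m (E tau q - v1 tau q)) p.
  exact/differentiable_mulmx/differentiableB.
rewrite /dx fluxE (deriveD (diff_derivable dflux)); last first.
  exact/diff_derivable/differentiableZ.
rewrite (deriveZ _ (diff_derivable dcorr)).
rewrite (deriveD _ (diff_derivable dflux)); last first.
  exact/diff_derivable/differentiable_mulmx.
by rewrite opprD [- _ - _]addrC addrNK opprD.
Qed.

End point.

(** In [residualE], [P(rho)] has order 0 and [tau E + r] order 2; the x-derivative keeps the
    order. *)
Lemma chapman_enskog_residual : bigO_tau tau0 Om 2 (fun tau p =>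
  dt (rho tau) p + dx (fun q => f_eq P Veq (rho tau q)) p
  - tau *: dx (fun q => mu_hat V D DV Dh (rho tau q) *m dx (rho tau) q) p).
Proof.
apply: regular_bigO_tau => n.
apply: (eq_regular_O _ _ Om_open _ _ (fun tau p =>
  - dx (fun q => P (rho tau q) *m (tau *: E tau q + r tau q)) p)).
  by move=> tau p t0 t1 Op; rewrite residualE.
apply: regular_ON => //; apply: reg_d => N.
apply: (regular_O_mulmx _ _ Om_open _ 0 2); first exact: reg_P.
by apply: regular_OD => //; exact: regular_OZtau.
Qed.

End family.
End chapman_enskog_expansion.

(** * Definiteness read off the diagonal part *)

Section definiteness.
Context {R : realType} {n : nat}.
Implicit Types A V : 'M[R]_n.

Lemma conj_diag_quadratic A V (x : 'cV[R]_n) : is_diag_mx A ->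
  (x^T *m (V *m A *m V^T) *m x) 0 0 = \sum_i A i i * (V^T *m x) i 0 ^+ 2.
Proof.
move=> dA; have -> : x^T *m (V *m A *m V^T) *m x =
    (V^T *m x)^T *m (A *m (V^T *m x)) by rewrite trmx_mul trmxK !mulmxA.
rewrite mxE; apply: eq_bigr => i _.
by rewrite mul_diag_mxE// [X in X * _]mxE mulrCA expr2.
Qed.

(** [V^T] sends column [i] of [V] to the i-th unit vector, so the quadratic form at that column
    singles out one eigenvalue. *)
Lemma conj_diag_eigenvector A V (i : 'I_n) : orthogonal_mx V -> is_diag_mx A ->
  ((col i V)^T *m (V *m A *m V^T) *m col i V) 0 0 = A i i.
Proof.
move=> /mulmx1C VV dA; rewrite conj_diag_quadratic// colE mulmxA VV mul1mx.
rewrite (bigD1 i)//= big1 => [|j ji]; rewrite mxE ?eqxx ?expr1n ?mulr1 ?addr0//.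
by rewrite (negbTE ji) expr0n mulr0.
Qed.

Lemma conj_diag_sym A V : is_diag_mx A -> (V *m A *m V^T)^T = V *m A *m V^T.
Proof.
move=> /is_diag_mxP dA; rewrite !trmx_mul trmxK mulmxA; congr (_ *m _ *m _).
apply/matrixP => i j; rewrite mxE; have [->//|ij] := eqVneq i j.
by rewrite !dA// eq_sym.
Qed.

Lemma conj_diag_semidefinite A V : orthogonal_mx V -> is_diag_mx A ->
  positive_semidefinite (V *m A *m V^T) <-> forall i, 0 <= A i i.
Proof.
move=> VV dA; split=> [[_ psd] i|A0].
  by rewrite -(conj_diag_eigenvector _ V)//; exact: psd.
split=> [|x]; first exact: conj_diag_sym.
by rewrite conj_diag_quadratic// sumr_ge0// => i _; rewrite mulr_ge0// sqr_ge0.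
Qed.

Lemma conj_diag_definite_gt0 A V i : orthogonal_mx V -> is_diag_mx A ->
  positive_definite (V *m A *m V^T) -> 0 < A i i.
Proof.
move=> VV dA [_ pd]; rewrite -(conj_diag_eigenvector _ V)//; apply: pd.
(* If the column were zero, its image under [V^T], a unit vector, would vanish too, giving
   [1 = 0]. *)
apply/eqP => /(congr1 (mulmx V^T)); rewrite colE mulmxA (mulmx1C VV) mul1mx.
rewrite mulmx0 => /matrixP/(_ i 0); rewrite !mxE !eqxx => /eqP.
by rewrite oner_eq0.
Qed.

(** [V] and [V^T] are invertible, and the determinant of [A] is a product of positive entries. *)
Lemma conj_diag_unitmx A V : orthogonal_mx V -> is_diag_mx A ->
  (forall i, 0 < A i i) -> V *m A *m V^T \in unitmx.
Proof.
move=> VV dA A0; have [uV uVT] := mulmx1_unit VV.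
rewrite !unitmx_mul uV uVT/= andbT unitmxE det_trig ?is_diag_mx_is_trig//.
by rewrite unitfE; apply/prodf_neq0 => i _; rewrite gt_eqF.
Qed.

End definiteness.

(** * Dissipativity and the sub-characteristic condition at one density *)

Section subcharacteristic.
Context {R : realType} {K : nat} (P D DV Dh : 'cV[R]_K.+1 -> 'M[R]_K.+1).
Context (V : 'M[R]_K.+1) (h Veq : 'cV[R]_K.+1 -> 'cV[R]_K.+1).
Context (rho : 'cV[R]_K.+1).
Hypothesis V_orth : orthogonal_mx V.
Hypothesis D_diag : is_diag_mx (D rho).
Hypothesis P_diag : P rho = V *m D rho *m V^T.
Hypothesis P_definite : positive_definite (P rho).
Hypotheses (DV_diag : is_diag_mx (DV rho)) (Dh_diag : is_diag_mx (Dh rho)).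

Let D_gt0 i : 0 < D rho i i.
Proof.
by apply: (conj_diag_definite_gt0 _ _ _ V_orth); rewrite -?P_diag.
Qed.

(** Positive definiteness makes [P(rho)] invertible, so [invmx] cancels: this [z] describes the
    local equilibrium. *)
Lemma equilibrium_velocity :
  velocity P h rho (P rho *m (Veq rho + h rho)) = Veq rho.
Proof.
by rewrite /velocity mulKmx ?addrK// P_diag conj_diag_unitmx.
Qed.

(** The eigenvalues are [D_ii^2 (- DV_ii) (DV_ii + Dh_ii)], and the first two factors are
    positive. *)
Lemma mu_hat_semidefinite : (forall i, DV rho i i < 0) ->
  positive_semidefinite (mu_hat V D DV Dh rho) <->
  forall i, 0 <= DV rho i i + Dh rho i i.
Proof.
move=> DV0.
have dS := is_diag_mxD _ _ DV_diag Dh_diag.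
have dD2 := is_diag_mx_mul _ _ D_diag D_diag.
set A := D rho ^+ 2 *m DV rho *m (DV rho + Dh rho).
have dA : is_diag_mx A by rewrite /A expr2 !is_diag_mx_mul.
have dNA : is_diag_mx (- A).
  apply/is_diag_mxP => i j ij.
  by rewrite mxE (is_diag_mxP dA i j ij) oppr0.
have -> : mu_hat V D DV Dh rho = V *m (- A) *m V^T.
  by rewrite mulmxN mulNmx.
rewrite conj_diag_semidefinite//.
have AE i : (- A) i i = D rho i i ^+ 2 * (- DV rho i i) *
    (DV rho i i + Dh rho i i).
  rewrite mxE /A expr2 mul_diag_mxE ?is_diag_mx_mul// !mul_diag_mxE//.
  by rewrite mxE mulrN mulNr.
by split=> + i => /(_ i); rewrite AE pmulr_rge0// mulr_gt0 ?exprn_gt0 ?oppr_gt0.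
Qed.

(** At equilibrium the terms [D(Veq(rho))] cancel and the gap between the speeds is
    [D_ii (DV_ii + Dh_ii)] with [D_ii > 0]. *)
Lemma subcharacteristic_lower z : velocity P h rho z = Veq rho ->
  diag_le (lambda1 P D h Dh rho z) (lambda_eq D Veq DV rho) <->
  forall i, 0 <= DV rho i i + Dh rho i i.
Proof.
move=> vz; rewrite /diag_le /lambda1 /lambda_eq vz.
have E i : ((D (Veq rho) - Dh rho *m D rho) i i <=
    (D (Veq rho) + D rho *m DV rho) i i) = (0 <= DV rho i i + Dh rho i i).
  rewrite [in LHS]mxE [in leRHS]mxE lerD2l [leLHS]mxE !mul_diag_mxE//.
  rewrite -subr_ge0 opprK [Dh rho i i * _]mulrC -mulrDr pmulr_rge0//.
by split=> + i => /(_ i); rewrite E.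
Qed.

(** The gap is [- D_ii DV_ii > 0], so this half is automatic and the equivalence rests on the lower
    inequality. *)
Lemma subcharacteristic_upper z : velocity P h rho z = Veq rho ->
  (forall i, DV rho i i < 0) ->
  diag_le (lambda_eq D Veq DV rho) (lambda2 P D h rho z).
Proof.
move=> vz DV0 i; rewrite /lambda_eq /lambda2 vz mxE mul_diag_mxE// gerDl.
by rewrite pmulr_rle0// ltW.
Qed.

End subcharacteristic.

(** * Linearity of [Pmx] and symmetry of the Galerkin product *)

Section galerkin_product.
Context {R : realType} {K : nat} (mu : probability R R).
Context (phi : 'I_K.+1 -> R -> R).

Lemma Pmx_linear : linear (Pmx mu phi).
Proof.
move=> a x y; rewrite /Pmx scaler_sumr -big_split/=; apply: eq_bigr => k _.
by rewrite !mxE scalerDl scalerA.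
Qed.

(** Lets [Pmx] instantiate the linear map [P] of the expansion. *)
HB.instance Definition _ := GRing.isLinear.Build R 'cV[R]_K.+1 'M[R]_K.+1 _
  (Pmx mu phi) Pmx_linear.

(** The triple-product integral is symmetric in [k] and [l], so exchanging the two sums swaps the
    roles of [a] and [b]. *)
Lemma galerkin_productC a b : Pmx mu phi a *m b = Pmx mu phi b *m a.
Proof.
have prodE (x y : 'cV[R]_K.+1) i j : (Pmx mu phi x *m y) i j =
    \sum_k \sum_l x k 0 * y l 0 * Mmx mu phi k i l.
  rewrite /Pmx mulmx_suml summxE; apply: eq_bigr => k _.
  rewrite mxE; apply: eq_bigr => l _; rewrite !mxE.
  by rewrite ord1 mulrAC.
apply/matrixP => i j; rewrite !prodE exchange_big/=.
apply: eq_bigr => l _; apply: eq_bigr => k _.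
rewrite [a k 0 * _]mulrC; congr (_ * _); rewrite !mxE.
congr (\int[_]_(_ in _) _); apply/funext => x.
by ring.
Qed.

End galerkin_product.

Theorem theorem4p1 (R : realType) (d : measure_display) (T : measurableType d)
    (Pr : probability T R) (xi : {RV Pr >-> R})
    (K : nat) (phi : 'I_K.+1 -> R -> R)
    (V : 'M[R]_K.+1) (D : 'cV[R]_K.+1 -> 'M[R]_K.+1)
    (h Veq : 'cV[R]_K.+1 -> 'cV[R]_K.+1)
    (Dh DV : 'cV[R]_K.+1 -> 'M[R]_K.+1) :
  let law := distribution Pr xi in
  let P := Pmx law phi in
  let H := Hplus law phi in
  gpc_basis law phi ->
  A1 law phi -> A2 law phi V D -> A3 law phi ->
  smooth_on H h -> smooth_on H Veq ->
  (forall rho, H rho ->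
     [/\ is_diag_mx (DV rho), is_diag_mx (Dh rho),
         Jacobian Veq rho = V *m DV rho *m V^T &
         Jacobian h rho = V *m Dh rho *m V^T]) ->
  (forall (tau0 : R) (Om : set (R * R))
      (rho v v1 r : R -> R * R -> 'cV[R]_K.+1),
     0 < tau0 -> open Om ->
     solution_family H P h Veq tau0 Om rho v ->
     chapman_enskog Veq tau0 Om rho v v1 r ->
     bigO_tau tau0 Om 2 (fun tau p =>
       dt (rho tau) p + dx (fun q => f_eq P Veq (rho tau q)) p
       - tau *: dx (fun q => mu_hat V D DV Dh (rho tau q) *m dx (rho tau) q) p))
  /\
  (forall rho, H rho ->
     (forall i, DV rho i i < 0) ->
     let z := P rho *m (Veq rho + h rho) in
     positive_semidefinite (mu_hat V D DV Dh rho) <->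
     diag_le (lambda1 P D h Dh rho z) (lambda_eq D Veq DV rho) /\
     diag_le (lambda_eq D Veq DV rho) (lambda2 P D h rho z)).
Proof.
move=> law P H _ _ [V_orth P_diag] _ h_smooth Veq_smooth jacobians; split.
  move=> tau0 Om rho v v1 r _ Om_open rhoP vP.
  by apply: (chapman_enskog_residual (Pmx law phi) V D H h) vP => //;
    exact: galerkin_productC.
move=> rho Hrho DV0 z; have [dDV dDh _ _] := jacobians _ Hrho.
have [dD PE] := P_diag rho.
have vz : velocity P h rho z = Veq rho.
  exact: (equilibrium_velocity P D V h Veq rho V_orth dD PE Hrho).
(* Both sides now contain the same sign condition on [DV_ii + Dh_ii]; only the upper inequality is
   left to supply. *)
rewrite (mu_hat_semidefinite P)// (subcharacteristic_lower _ _ _ _ V)//.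
split=> [S0|[]//]; split=> //.
exact: (subcharacteristic_upper P D DV V).
Qed.
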